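(* Let $\mathcal A$ be the unital associative algebra with generators $\mathcal X,\mathcal Z$ and defining relation $[\mathcal Z,\mathcal X]=\mathcal Z^2+\Delta$, in the case $\Delta<0$; by rescaling both generators by a common factor, take $\Delta=-\tfrac14$. Consider a tridiagonal representation $\mathcal X\mapsto X$, $\mathcal Z\mapsto Z$ of $\mathcal A$ on an orthonormal basis $|n\rangle$, $$X|n\rangle=c_n|n-1\rangle+b_n|n\rangle+a_n|n+1\rangle,\qquad Z|n\rangle=u_n|n-1\rangle+v_n|n\rangle+w_n|n+1\rangle,\qquad c_0=u_0=0,$$ with parameters $\phi_0,\delta_0,v_0,\tilde b_0$ as defined in the context, which is finite-dimensional, of dimension $N+1$, by virtue of the condition $$N+1=-\tfrac12\left[\phi_0-\delta_0-1\pm(\phi_0-\delta_0+1)\,v_0\sqrt{-\Delta^{-1}}\right].$$ Choose the parameters as $$\phi_0=\beta,\qquad -\delta_0=\alpha+1,\qquad v_0=-\frac{\alpha+\beta+2N+2}{2(\alpha+\beta+2)},\qquad \tilde b_0=\tfrac14(2N-\alpha+\beta),$$ so that this condition is satisfied. Then the eigenfunctions $p_n(x)$ of $X$, that is, the monic polynomials with $$x\,p_n(x)=a_{n-1}c_n\,p_{n-1}(x)+b_n\,p_n(x)+p_{n+1}(x),$$ are given in terms of the monic Hahn polynomials $Q_n^{(\alpha,\beta)}(x)$.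
   Context: Off-diagonal coefficients of the representation are assumed non-zero (apart from $c_0=u_0=0$ and the truncation $w_N=a_N=0$). The relation of $\mathcal A$ forces $c_n/u_n=\phi_0+n$ and $a_n/w_n=\delta_0-n$ with constants $\phi_0,\delta_0$; $v_0$ is the coefficient of $|0\rangle$ in $Z|0\rangle$, and $\tilde b_0=b_0-\tfrac12(\delta_0+\phi_0+1)v_0$. It gives $$a_{n-1}c_n=\frac{n(n+\phi_0)(n-\delta_0-1)(n+\phi_0-\delta_0-1)\left(\Delta(2n+\phi_0-\delta_0-1)^2+v_0^2(\phi_0-\delta_0+1)^2\right)}{(2n+\phi_0-\delta_0-1)^2(2n+\phi_0-\delta_0)(2n+\phi_0-\delta_0-2)},$$ $$b_n=\frac12\,\frac{(\delta_0+\phi_0+1)(\phi_0-\delta_0+1)(\phi_0-\delta_0-1)v_0}{(2n+\phi_0-\delta_0-1)(2n+\phi_0-\delta_0+1)}+\tilde b_0 .$$ The displayed condition on $N+1$ makes $a_Nc_{N+1}$ vanish. If $\langle x|X=x\langle x|$ and $q_n(x)=\langle x|n\rangle$, then $p_n=\left(\prod_{i=0}^{n-1}a_i\right)q_n$. With the choice of parameters in the claim, $$a_{n-1}c_n=\frac{n(n+\alpha)(n+\beta)(n+\alpha+\beta)(n+\alpha+\beta+N+1)(N-n+1)}{(2n+\alpha+\beta-1)(2n+\alpha+\beta)^2(2n+\alpha+\beta+1)},$$ $$b_n=\frac{(n+\alpha+\beta+1)(n+\alpha+1)(N-n)}{(2n+\alpha+\beta+1)(2n+\alpha+\beta+2)}+\frac{n(n+\alpha+\beta+N+1)(n+\beta)}{(2n+\alpha+\beta)(2n+\alpha+\beta+1)},$$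 which are the recurrence coefficients of the monic Hahn polynomials with parameters $\alpha,\beta,N$. The Hahn polynomials are, up to normalization, ${}_3F_2\!\left({-n,\;n+\alpha+\beta+1,\;-x\atop \alpha+1,\;-N};1\right)$, $0\le n\le N$; ''monic'' means normalized to leading coefficient $1$. *)

(* Defs.v *)
From HB Require Import structures.
From mathcomp Require Import all_boot all_order all_algebra.

Set Implicit Arguments.
Unset Strict Implicit.
Unset Printing Implicit Defensive.

Import Order.TTheory GRing.Theory Num.Theory.
Local Open Scope ring_scope.
Local Open Scope sesquilinear_scope.

Definition defining_relation (C : numClosedFieldType) (Delta : C)
    (B : algType C) (x z : B) : Prop :=
  z * x - x * z = z ^+ 2 + Delta%:A.

(* The algebra given by generators and relations is characterised, up to a
   unique isomorphism preserving the generators, by its universal property. *)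
Record presented_by (C : numClosedFieldType) (Delta : C)
    (A : algType C) (cX cZ : A) : Prop := PresentedBy {
  presented_relation : defining_relation Delta cX cZ;
  presented_universal : forall (B : algType C) (x z : B),
    defining_relation Delta x z ->
    exists f : {lrmorphism A -> B},
      [/\ f cX = x, f cZ = z
        & forall g : {lrmorphism A -> B}, g cX = x -> g cZ = z -> g =1 f]
}.

(* The basis is |0>, ..., |N>; the value e n is irrelevant for n > N. *)
Definition orthonormal_basis (C : numClosedFieldType) (N : nat)
    (e : nat -> 'cV[C]_N.+1) : Prop :=
  forall m n, (m <= N)%N -> (n <= N)%N ->
    ((e m)^t* *m e n) 0 0 = (m == n)%:R.

(* At the two ends, e n.-1 and e n.+1 are not meant as further basis vectors:
   lower 0 and upper N are required to vanish in tridiagonal_rep. *)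
Definition acts_tridiagonally (C : numClosedFieldType) (N : nat)
    (e : nat -> 'cV[C]_N.+1) (T : 'M[C]_N.+1)
    (lower diag upper : nat -> C) : Prop :=
  forall n, (n <= N)%N ->
    T *m e n = lower n *: e n.-1 + diag n *: e n + upper n *: e n.+1.

Record tridiagonal_rep (C : numClosedFieldType) (A : algType C) (cX cZ : A)
    (N : nat) (rho : {lrmorphism A -> 'M[C]_N.+1}) (e : nat -> 'cV[C]_N.+1)
    (c b a u v w : nat -> C) : Prop := TridiagonalRep {
  rep_basis : orthonormal_basis e;
  rep_X : acts_tridiagonally e (rho cX) c b a;
  rep_Z : acts_tridiagonally e (rho cZ) u v w;
  rep_bottom : c 0%N = 0 /\ u 0%N = 0;
  rep_top : a N = 0 /\ w N = 0;
  rep_lower_neq0 : forall n, (0 < n <= N)%N -> c n != 0 /\ u n != 0;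
  rep_upper_neq0 : forall n, (n < N)%N -> a n != 0 /\ w n != 0
}.

Record rep_parameters (C : numClosedFieldType) (N : nat)
    (c b a u v w : nat -> C) (phi0 delta0 v0 bt0 : C) : Prop :=
  RepParameters {
  param_phi0 : forall n, (0 < n <= N)%N -> c n / u n = phi0 + n%:R;
  param_delta0 : forall n, (n < N)%N -> a n / w n = delta0 - n%:R;
  param_v0 : v0 = v 0%N;
  param_bt0 : bt0 = b 0%N - 2^-1 * (delta0 + phi0 + 1) * v0
}.

(* The boolean sgn selects the sign in front of the square root term. *)
Definition dimension_condition (C : numClosedFieldType) (Delta : C) (N : nat)
    (phi0 delta0 v0 : C) : Prop :=
  exists sgn : bool,
    N.+1%:R = - 2^-1 * (phi0 - delta0 - 1
                + (-1) ^+ sgn * ((phi0 - delta0 + 1) * v0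
                                 * sqrtC (- Delta^-1))).

(* For n = 0 the term with p n.-1 drops out because c 0 = 0. *)
Definition monic_recurrence (C : numClosedFieldType) (N : nat)
    (c b a : nat -> C) (p : nat -> {poly C}) : Prop :=
  p 0%N = 1 /\
  forall n, (n <= N)%N ->
    'X * p n = (a n.-1 * c n) *: p n.-1 + b n *: p n + p n.+1.

Definition poch (B : nzRingType) (x : B) (k : nat) : B :=
  \prod_(i < k) (x + i%:R).

(* 3F2(-n, n+alpha+beta+1, -x; alpha+1, -N; 1) as a polynomial in x; the
   series stops at k = n since (-n)_k = 0 for k > n. For n <= N the factors
   (-N)_k that occur are non-zero. *)
Definition hahn_3F2 (C : numClosedFieldType) (alpha beta : C) (N n : nat) :
    {poly C} :=
  \sum_(k < n.+1)
    (poch (- n%:R) k * poch (n%:R + alpha + beta + 1) k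
      / (poch (alpha + 1) k * poch (- N%:R) k * k`!%:R))
    *: poch (- 'X) k.

Definition monic_hahn (C : numClosedFieldType) (alpha beta : C) (N n : nat) :
    {poly C} :=
  (lead_coef (hahn_3F2 alpha beta N n))^-1 *: hahn_3F2 alpha beta N n.

(* Main.v *)
(** The entries of [Z, X] = Z^2 + Delta in the given basis are three first-order
recurrences in n, for the v_n, the b_n and the products w_{n-1} u_n. They
telescope; with s = alpha + beta they give v_n = v_0 s (s+2) / ((s+2n) (s+2n+2))
and the closed form of w_{n-1} u_n, hence those of b_n and a_{n-1} c_n. The
closed forms have denominators s + m with 2 <= m <= 2N: a vanishing one would
force v_0 = 0 or a forbidden zero of the numerator, so such parameters admit no
representation. The Hahn polynomials satisfy the same three-term recurrence, as
one sees by comparing coefficients in the basis (-x)_k, and a three-term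
recurrence determines its solution from the first term. *)

Require Import Defs.
From HB Require Import structures.
From mathcomp Require Import all_boot all_order all_algebra.
From mathcomp Require Import ring zify.

Set Implicit Arguments.
Unset Strict Implicit.
Unset Printing Implicit Defensive.

Import Order.TTheory GRing.Theory Num.Theory.
Local Open Scope ring_scope.
Local Open Scope sesquilinear_scope.

(** * Pochhammer symbols of scalars and of the polynomial -X *)

Lemma poch0 (B : nzRingType) (x : B) : poch x 0 = 1.
Proof. by rewrite /poch big_ord0. Qed.

Lemma pochSr (B : nzRingType) (x : B) k : poch x k.+1 = poch x k * (x + k%:R).
Proof. by rewrite /poch big_ord_recr. Qed.

Lemma pochS (B : nzRingType) (x : B) k : poch x k.+1 = x * poch (x + 1) k.
Proof.
rewrite /poch big_ord_recl addr0; congr (_ * _); apply: eq_bigr => i _.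
by rewrite lift0 -natr1 -addrA [1 + _]addrC.
Qed.

Lemma poch_neq0 (B : idomainType) (x : B) k :
  (forall i, (i < k)%N -> x + i%:R != 0) -> poch x k != 0.
Proof. by move=> nz; apply/prodf_neq0 => i _; apply: nz. Qed.

Lemma poch_oppn (B : nzRingType) n k : (n < k)%N -> poch (- n%:R : B) k = 0.
Proof.
elim: k => // k IH; rewrite ltnS leq_eqVlt pochSr => /orP[/eqP<-|/IH->].
  by rewrite addNr mulr0.
by rewrite mul0r.
Qed.

Lemma natrB_neq0 (C : numDomainType) m n : m != n -> - n%:R + m%:R != 0 :> C.
Proof. by move=> mn; rewrite addrC subr_eq0 eqr_nat. Qed.

Lemma size_poch_oppX (C : idomainType) k : size (poch (- 'X : {poly C}) k) = k.+1.
Proof.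
elim: k => [|k IH]; first by rewrite poch0 size_poly1.
have E : - 'X + k%:R = - ('X - k%:R%:P) :> {poly C}.
  by rewrite opprB addrC polyC_natr.
by rewrite pochSr E mulrN size_polyN size_Mmonic ?monicXsubC -?size_poly_gt0 ?IH
  // size_XsubC addn2.
Qed.

Lemma lead_coef_poch_oppX (C : idomainType) k :
  lead_coef (poch (- 'X : {poly C}) k) = (-1) ^+ k.
Proof.
elim: k => [|k IH]; first by rewrite poch0 lead_coef1.
have E : - 'X + k%:R = - ('X - k%:R%:P) :> {poly C}.
  by rewrite opprB addrC polyC_natr.
by rewrite pochSr E mulrN lead_coefN lead_coef_Mmonic ?monicXsubC // IH exprS mulN1r.
Qed.

(** * Three-term recurrence of the Hahn polynomials *)

Definition hahn_coef (C : numClosedFieldType) (alpha beta : C) (N n k : nat) : C :=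
  poch (- n%:R) k * poch (n%:R + alpha + beta + 1) k
      / (poch (alpha + 1) k * poch (- N%:R) k * k`!%:R).

(* At n = 0 the factor n + alpha + beta + 1 cancels against 2 n + alpha + beta + 1,
   which is allowed to vanish. *)
Definition hahnA (C : numClosedFieldType) (alpha beta : C) (N n : nat) : C :=
  if n is 0 then (alpha + 1) * N%:R / (alpha + beta + 2)
  else (n%:R + alpha + beta + 1) * (n%:R + alpha + 1) * (N%:R - n%:R)
       / ((2 * n%:R + alpha + beta + 1) * (2 * n%:R + alpha + beta + 2)).

(** Together with [hahnA], the coefficients in -x H_n = A_n H_(n+1) - (A_n + C_n) H_n + C_n
    H_(n-1). *)
Definition hahnC (C : numClosedFieldType) (alpha beta : C) (N n : nat) : C :=
  n%:R * (n%:R + alpha + beta + N%:R + 1) * (n%:R + beta)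
  / ((2 * n%:R + alpha + beta) * (2 * n%:R + alpha + beta + 1)).

(** The first condition keeps (alpha + 1)_k non-zero for k <= N. The second covers the denominators
    of A_n and C_n for 0 < n < N and that of A_0; alpha + beta + 1 may vanish. *)
Definition hahn_regular (C : numClosedFieldType) (alpha beta : C) (N : nat) : Prop :=
  (forall k, (k < N)%N -> alpha + 1 + k%:R != 0) /\
  (forall m, (1 < m <= N.*2)%N -> alpha + beta + m%:R != 0).

Section Hahn.
Variables (C : numClosedFieldType) (alpha beta : C) (N : nat).
Hypothesis reg : hahn_regular alpha beta N.
Local Notation h := (hahn_coef alpha beta N).
Local Notation H := (hahn_3F2 alpha beta N).
Local Notation A := (hahnA alpha beta N).
Local Notation Cn := (hahnC alpha beta N).

Lemma hahn_coef0 n : h n 0 = 1.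
Proof. by rewrite /hahn_coef !poch0 fact0 !mulr1 divr1. Qed.

Lemma hahn_coef_gt n k : (n < k)%N -> h n k = 0.
Proof. by move=> nk; rewrite /hahn_coef poch_oppn // !mul0r. Qed.

(** The terms beyond n vanish, so expansions of different degrees can share one index range. *)
Lemma hahn_sum K n : (n < K)%N -> H n = \sum_(k < K) h n k *: poch (- 'X) k.
Proof.
move=> nK; rewrite /hahn_3F2 (big_ord_widen K (fun k => h n k *: poch (- 'X) k)) //.
rewrite big_mkcond; apply: eq_bigr => i _.
by case: ltnP => // ni; rewrite hahn_coef_gt ?scale0r.
Qed.

Lemma poch_alpha_neq0 k : (k <= N)%N -> poch (alpha + 1) k != 0.
Proof. by move=> kN; apply: poch_neq0 => i ik; apply: reg.1; apply: leq_trans kN. Qed.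

Lemma poch_N_neq0 k : (k <= N)%N -> poch (- N%:R : C) k != 0.
Proof.
move=> kN; apply: poch_neq0 => i ik; apply: natrB_neq0.
by rewrite ltn_eqF // (leq_trans ik).
Qed.

Lemma fact_neq0 k : k`!%:R != 0 :> C.
Proof. by rewrite pnatr_eq0 -lt0n fact_gt0. Qed.

Lemma regular_neq0 m x : (1 < m <= N.*2)%N -> x = alpha + beta + m%:R -> x != 0.
Proof. by move=> mN ->; apply: reg.2. Qed.

Lemma denominators_neq0 n : (n.+1 < N)%N ->
  [/\ 2 * n.+1%:R + alpha + beta != 0, 2 * n.+1%:R + alpha + beta + 1 != 0
    & 2 * n.+1%:R + alpha + beta + 2 != 0].
Proof.
move=> nN.
have nz i : (i <= 2)%N -> 2 * n.+1%:R + alpha + beta + i%:R != 0.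
  move=> i2; apply: (@regular_neq0 (n.+1.*2 + i)); first by lia.
  by rewrite natrD -mul2n natrM; ring.
by split; [rewrite -[X in X != 0]addr0; apply: (nz 0%N) | apply: (nz 1%N) | apply: (nz 2%N)].
Qed.

(** Comparison of the coefficients of (-x)_(k+1) in the recurrence; the left side comes from -x
    (-x)_k = (-x)_(k+1) - k (-x)_k. *)
Lemma hahn_coef_rec n k : (n < N)%N -> (k <= n)%N ->
  h n k - k.+1%:R * h n k.+1 =
  A n * h n.+1 k.+1 - (A n + Cn n) * h n k.+1 + Cn n * h n.-1 k.+1.
Proof.
move=> nN kn.
have kN := leq_ltn_trans kn nN.
have a1 := poch_alpha_neq0 kN; have N1 := poch_N_neq0 kN.
case: n => [|n] in nN kn *.
  have k0 : k = 0%N by case: k kn {kN a1 N1}.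
  rewrite k0 !pochSr !poch0 !mul1r !addr0 in a1 N1 *.
  rewrite hahn_coef0 (@hahn_coef_gt 0 1) // !mulr0 !subr0 addr0.
  rewrite /hahnA /hahn_coef !pochSr !poch0 factS fact0.
  have s2 : alpha + beta + 2 != 0 by apply: (@regular_neq0 2) => //; lia.
  field.
  by rewrite a1 -oppr_eq0 N1 s2.
set x : C := n.+1%:R.
have x1 : n.+2%:R = x + 1 by rewrite /x [RHS]natr1.
have x0 : n%:R = x - 1 by rewrite /x -natr1 addrK.
have [s0 s1 s2] := denominators_neq0 nN.
rewrite -/x in s0 s1 s2.
case: k => [|j] in kn kN a1 N1 *.
  rewrite hahn_coef0 /hahnA /hahnC /hahn_coef /= x1 x0 -/x !pochSr !poch0 factS fact0.
  rewrite !pochSr !poch0 !mul1r !addr0 in a1 N1.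
  clearbody x; field.
  by rewrite a1 -oppr_eq0 N1 s0 s1 s2.
rewrite /hahnA /hahnC /hahn_coef /= x1 x0 -/x.
set y : C := j%:R.
have y1 : j.+1%:R = y + 1 by rewrite /y [RHS]natr1.
have y2 : j.+2%:R = y + 2 by rewrite /y -addn2 natrD.
(* The symbols whose base depends on n are all multiples of [G] or [E]; once they are factored out,
   a rational identity in [x] and [y] remains. *)
set G := poch (- x + 1) j; set E := poch (x + alpha + beta + 2) j.
have G1 : poch (- x) j.+1 = - x * G by rewrite pochS.
have G2 : poch (- x) j.+2 = - x * (G * (- x + 1 + y)) by rewrite pochS pochSr.
have G3 : poch (- (x + 1)) j.+2 = - (x + 1) * (- x * G).
  by rewrite pochS opprD subrK pochS.
have G4 : poch (- (x - 1)) j.+2 = G * (- x + 1 + y) * (- x + 2 + y).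
  by rewrite opprB [1 - x]addrC !pochSr -/G y1; ring.
have E1 : poch (x + alpha + beta + 1) j.+1 = (x + alpha + beta + 1) * E.
  by rewrite pochS -[_ + 1 + 1]addrA.
have E2 : poch (x + alpha + beta + 1) j.+2 =
    (x + alpha + beta + 1) * (E * (x + alpha + beta + 2 + y)).
  by rewrite pochS -[_ + 1 + 1]addrA pochSr.
have E3 : poch (x + 1 + alpha + beta + 1) j.+2 =
    E * (x + alpha + beta + 2 + y) * (x + alpha + beta + 3 + y).
  have -> : x + 1 + alpha + beta + 1 = x + alpha + beta + 2 by ring.
  by rewrite !pochSr -/E y1; ring.
have E4 : poch (x - 1 + alpha + beta + 1) j.+2 =
    (x + alpha + beta) * ((x + alpha + beta + 1) * E).
  have -> : x - 1 + alpha + beta + 1 = x + alpha + beta by ring.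
  by rewrite 2!pochS -[_ + 1 + 1]addrA.
rewrite G1 G2 G3 G4 E1 E2 E3 E4 !(pochSr _ j.+1).
rewrite [j.+2`!]factS natrM y1 y2.
rewrite !(pochSr _ j.+1) !mulf_eq0 !negb_or y1 in a1 N1.
case/andP: a1 => a1 a2; case/andP: N1 => N1 N2.
have f1 := fact_neq0 j.+1.
have y20 : y + 2 != 0 by rewrite -y2 pnatr_eq0.
clearbody x y; field.
by rewrite f1 y20 a1 a2 N1 N2 s0 s1 s2.
Qed.

Lemma hahn_3F2_rec n : (n < N)%N ->
  - 'X * H n = A n *: H n.+1 - (A n + Cn n) *: H n + Cn n *: H n.-1.
Proof.
move=> nN.
rewrite (@hahn_sum n.+2 n.+1) // (@hahn_sum n.+2 n.-1) ?(leq_ltn_trans (leq_pred n)) //.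
rewrite [in RHS](@hahn_sum n.+2 n) // [in LHS](@hahn_sum n.+1 n) //.
pose P k : {poly C} := poch (- 'X) k.
have XP k : - 'X * P k = P k.+1 - k%:R *: P k.
  by rewrite /P pochSr scaler_nat -mulr_natr; ring.
have -> : - 'X * (\sum_(k < n.+1) h n k *: P k) =
    \sum_(k < n.+1) (h n k - k.+1%:R * h n k.+1) *: P k.+1.
  rewrite mulr_sumr.
  under eq_bigr => k _ do rewrite -scalerAr XP scalerBr scalerA mulrC.
  under [RHS]eq_bigr => k _ do rewrite scalerBl.
  rewrite !sumrB; congr (_ - _).
  rewrite big_ord_recl mul0r scale0r add0r big_ord_recr /= hahn_coef_gt //.
  by rewrite mulr0 scale0r addr0.
have -> : A n *: (\sum_(k < n.+2) h n.+1 k *: P k) -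
    (A n + Cn n) *: (\sum_(k < n.+2) h n k *: P k) +
    Cn n *: (\sum_(k < n.+2) h n.-1 k *: P k) =
    \sum_(k < n.+2) (A n * h n.+1 k - (A n + Cn n) * h n k + Cn n * h n.-1 k) *: P k.
  rewrite !scaler_sumr -sumrB -big_split /=; apply: eq_bigr => k _.
  by rewrite !scalerA -scalerBl -scalerDl.
(* All three polynomials have coefficient 1 at (-x)_0, so that term is A - (A + C) + C = 0. *)
rewrite [RHS]big_ord_recl !hahn_coef0 !mulr1 opprD addrA subrr add0r addNr scale0r.
by rewrite add0r; apply: eq_bigr => k _; rewrite lift0 -hahn_coef_rec // -ltnS.
Qed.

(** Comparison of leading coefficients in the recurrence, (-1)^n being that of (-x)_n. *)
Lemma hahn_coef_diagS n : (n < N)%N ->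
  A n * (h n.+1 n.+1 * (-1) ^+ n.+1) = - (h n n * (-1) ^+ n).
Proof.
move=> nN; have a1 := poch_alpha_neq0 nN; have N1 := poch_N_neq0 nN.
rewrite /hahn_coef !(pochSr _ n) !mulf_eq0 !negb_or in a1 N1 *.
case/andP: a1 => a1 a2; case/andP: N1 => N1 N2; have f := fact_neq0 n.
case: n => [|n] in nN a1 a2 N1 N2 f *.
  rewrite addr0 in a2; rewrite -oppr_eq0 in N2; rewrite /hahnA !poch0 factS fact0.
  have s2 : alpha + beta + 2 != 0 by apply: (@regular_neq0 2) => //; lia.
  rewrite addr0 opprK in N2.
  field.
  by rewrite a2 N2 s2.
set x : C := n.+1%:R in a2 N2 *.
have x1 : n.+2%:R = x + 1 by rewrite /x [RHS]natr1.
have [s0 s1 s2] := denominators_neq0 nN.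
rewrite -/x in s0 s1 s2.
have s3 : x + alpha + beta + 1 != 0.
  by apply: (@regular_neq0 n.+2); [lia | rewrite x1; ring].
rewrite factS natrM x1 /hahnA -/x -pochSr pochS opprD subrK.
(* The base is shifted by (y)_(m+1) = y (y + 1)_m with y = x + alpha + beta + 1, which is non-zero
   by [s3]. *)
have -> : poch (x + 1 + alpha + beta + 1) n.+1 * (x + 1 + alpha + beta + 1 + x) =
   poch (x + alpha + beta + 1) n.+1 * (x + alpha + beta + 1 + x)
   * (x + alpha + beta + 2 + x) / (x + alpha + beta + 1).
  apply: (mulIf s3); rewrite divfK // -pochSr.
  have -> : x + 1 + alpha + beta + 1 = x + alpha + beta + 1 + 1 by ring.
  by rewrite mulrC -pochS !pochSr x1 -/x; ring.
have x10 : x + 1 != 0 by rewrite -x1 pnatr_eq0.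
rewrite exprS.
clearbody x; field.
by rewrite f N1 a1 x10 N2 a2 s3 s2 s1.
Qed.

(** By [hahn_coef_diagS] a zero at n + 1 would force a zero at n, whereas the value at 0 is 1. Hence
    the last summand has degree n and dominates the others. *)
Lemma lead_coef_hahn n : (n <= N)%N ->
  lead_coef (H n) = h n n * (-1) ^+ n /\ lead_coef (H n) != 0.
Proof.
move=> nN.
have nz : h n n * (-1) ^+ n != 0.
  elim: n nN => [|n IH] nN; first by rewrite hahn_coef0 mul1r oner_neq0.
  apply/eqP => E; have /eqP := hahn_coef_diagS nN.
  by rewrite E mulr0 eq_sym oppr_eq0 (negPf (IH (ltnW nN))).
suff E : lead_coef (H n) = h n n * (-1) ^+ n by rewrite E.
rewrite /hahn_3F2 big_ord_recr /= addrC lead_coefDl.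
  by rewrite -mul_polyC lead_coefM lead_coefC lead_coef_poch_oppX.
rewrite size_scale ?size_poch_oppX; last first.
  by apply: contraNneq nz; rewrite /hahn_coef => ->; rewrite mul0r.
rewrite ltnS; apply: (leq_trans (size_sum _ _ _)); apply/bigmax_leqP => i _.
by apply: (leq_trans (size_scale_leq _ _)); rewrite size_poch_oppX.
Qed.

(** The recurrence is divided by the leading coefficient of H_n; A_n lead(H_(n+1)) = - lead(H_n)
    then turns C_n into A_(n-1) C_n and makes the coefficient of the next polynomial 1. *)
Lemma monic_hahn_rec n : (n < N)%N ->
  'X * monic_hahn alpha beta N n =
    (A n.-1 * Cn n) *: monic_hahn alpha beta N n.-1
    + (A n + Cn n) *: monic_hahn alpha beta N n + monic_hahn alpha beta N n.+1.
Proof.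
move=> nN; rewrite /monic_hahn -[LHS]opprK -mulNr -scalerAr hahn_3F2_rec //.
have [l0 z0] := lead_coef_hahn (ltnW nN); have [l1 z1] := lead_coef_hahn nN.
have A1 : A n * lead_coef (H n.+1) = - lead_coef (H n) by rewrite l0 l1 hahn_coef_diagS.
(* At n = 0 both sides vanish because C_0 = 0. *)
have C1 : A n.-1 * Cn n * lead_coef (H n) = - Cn n * lead_coef (H n.-1).
  case: n nN {l0 z0 l1 z1 A1} => [|n] nN /=; first by rewrite /hahnC !mul0r mulr0 oppr0 !mul0r.
  have [l0 _] := lead_coef_hahn (ltnW nN).
  have [l1 _] := lead_coef_hahn (ltnW (ltnW nN)).
  by rewrite l0 l1 mulrAC hahn_coef_diagS ?(ltnW nN) // mulNr mulrC mulNr.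
have [_ z2] := lead_coef_hahn (leq_trans (leq_pred n) (ltnW nN)).
rewrite scalerDr scalerBr !scalerA !opprD opprK -!scaleNr addrC addrA.
rewrite -addrA [X in _ + X = _]addrC addrA.
congr (_ *: _ + _ *: _ + _ *: _).
- by apply: (mulIf z2); apply: (mulfI z0); rewrite divfK // [RHS]mulrC C1; field.
- by rewrite mulrC.
by apply: (mulIf z1); rewrite mulVf // mulNr -mulrA A1 mulrN opprK mulVf.
Qed.

End Hahn.

(** * Rescaling of the generators *)

(** The relation is homogeneous of degree two if Delta is given degree two; a pair in B is scaled
    back by lam^-1 before the universal property is applied. *)
Lemma presented_by_scale (C : numClosedFieldType) (Delta lam : C) (A : algType C)
    (cX cZ : A) : lam != 0 -> presented_by Delta cX cZ ->
  presented_by (lam ^+ 2 * Delta) (lam *: cX) (lam *: cZ).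
Proof.
have scale_rel (B : algType C) (mu D : C) (x z : B) : defining_relation D x z ->
    defining_relation (mu ^+ 2 * D) (mu *: x) (mu *: z).
  rewrite /defining_relation exprZn -!scalerAl -!scalerAr !scalerA -scalerBr => ->.
  by rewrite scalerDr scalerA.
move=> l0 [rel univ]; split=> [|B x z relB]; first exact: scale_rel.
have [|f [fX fZ f_uniq]] := univ B (lam^-1 *: x) (lam^-1 *: z).
  by have := scale_rel _ lam^-1 _ _ _ relB; rewrite mulrA -exprMn mulVf // expr1n mul1r.
exists f; split=> [||g gX gZ].
- by rewrite linearZ /= fX scalerA divff // scale1r.
- by rewrite linearZ /= fZ scalerA divff // scale1r.
apply: f_uniq.
- by rewrite -gX linearZ /= scalerA mulVf // scale1r.
by rewrite -gZ linearZ /= scalerA mulVf // scale1r.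
Qed.

(** * Uniqueness for three-term recurrences, and linear combinations of equations *)

(** The induction carries two consecutive values. The type [T] is arbitrary so as to serve both
    polynomials and their values at a point. *)
Lemma three_term_unique (T : Type) (G : nat -> T -> T -> T) (f g : nat -> T) N :
  f 0%N = g 0%N ->
  (forall n, (n < N)%N -> f n.+1 = G n (f n) (f n.-1)) ->
  (forall n, (n < N)%N -> g n.+1 = G n (g n) (g n.-1)) ->
  forall n, (n <= N)%N -> f n = g n.
Proof.
move=> fg0 fG gG n.
suff: (n <= N)%N -> f n = g n /\ f n.-1 = g n.-1 by move=> E /E[].
elim: n => [|n IH] nN //=; have [E1 E2] := IH (ltnW nN).
by rewrite fG // gG // E1 E2.
Qed.

(** A certificate rule: [k] is the cofactor of the known equation, and the last premise is left to
    [ring] or [field]. *)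
Lemma lincomb1 (C : comNzRingType) (k a b c d : C) :
  a = b -> c - d = k * (a - b) -> c = d.
Proof. by move=> ->; rewrite subrr mulr0 => /eqP; rewrite subr_eq0 => /eqP. Qed.

Lemma lincomb2 (C : comNzRingType) (k1 k2 a1 b1 a2 b2 c d : C) :
  a1 = b1 -> a2 = b2 -> c - d = k1 * (a1 - b1) + k2 * (a2 - b2) -> c = d.
Proof. by move=> -> ->; rewrite !subrr !mulr0 addr0 => /eqP; rewrite subr_eq0 => /eqP. Qed.

(* For k = 0 the first two terms both sit at m = 0; only the case l 0 = 0 is used. *)
Definition tri (C : nzRingType) (l d u : nat -> C) (m k : nat) : C :=
  l k * (m == k.-1)%:R + d k * (m == k)%:R + u k * (m == k.+1)%:R.

Ltac decide_eqn := repeat match goal with |- context [@eq_op _ ?x ?y] =>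
  first [rewrite (_ : (x == y) = false); [|by lia] | rewrite (_ : (x == y) = true); [|by lia]]
end.

(** * Matrix entries of the defining relation and the recurrences they yield *)

Section Tridiagonal.
Variables (C : numClosedFieldType) (N : nat) (e : nat -> 'cV[C]_N.+1).
Hypothesis orth : orthonormal_basis e.

Let coef m (y : 'cV[C]_N.+1) : C := ((e m)^t* *m y) 0 0.

Let coefD m x y : coef m (x + y) = coef m x + coef m y.
Proof. by rewrite /coef mulmxDr mxE. Qed.

Let coefZ m z x : coef m (z *: x) = z * coef m x.
Proof. by rewrite /coef -scalemxAr mxE. Qed.

Lemma tri_coef (T : 'M[C]_N.+1) (l d u : nat -> C) m k :
  acts_tridiagonally e T l d u -> u N = 0 -> (m <= N)%N -> (k <= N)%N ->
  coef m (T *m e k) = tri l d u m k.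
Proof.
move=> actT uN mN kN; rewrite actT // !coefD !coefZ.
have kN' := leq_trans (leq_pred k) kN.
rewrite /tri /coef (orth mN kN) (orth mN kN'); congr (_ + _).
(* For k = N the vector [e k.+1] lies outside the basis; its term disappears because [u N = 0]. *)
move: kN; rewrite leq_eqVlt => /orP[/eqP ->|kN]; last by rewrite orth.
by rewrite uN !mul0r.
Qed.

Lemma tri_comp_coef (S T : 'M[C]_N.+1) (l1 d1 u1 l2 d2 u2 : nat -> C) m k :
  acts_tridiagonally e S l2 d2 u2 -> u2 N = 0 ->
  acts_tridiagonally e T l1 d1 u1 -> u1 N = 0 -> (m <= N)%N -> (k <= N)%N ->
  coef m (S *m T *m e k) =
    l1 k * tri l2 d2 u2 m k.-1 + d1 k * tri l2 d2 u2 m k + u1 k * tri l2 d2 u2 m k.+1.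
Proof.
move=> actS u2N actT u1N mN kN.
rewrite -mulmxA actT // !mulmxDr -!scalemxAr !coefD !coefZ.
have kN' := leq_trans (leq_pred k) kN.
rewrite (tri_coef actS u2N mN kN) (tri_coef actS u2N mN kN'); congr (_ + _).
move: kN; rewrite leq_eqVlt => /orP[/eqP ->|kN]; last by rewrite (tri_coef actS).
by rewrite u1N !mul0r.
Qed.

Variables (A : algType C) (cX cZ : A) (Delta : C).
Variables (rho : {lrmorphism A -> 'M[C]_N.+1}) (c b a u v w : nat -> C).
Hypothesis rel : defining_relation Delta cX cZ.
Hypothesis rep : tridiagonal_rep cX cZ rho e c b a u v w.

Lemma relation_entry m n : (m <= N)%N -> (n <= N)%N ->
  (c n * tri u v w m n.-1 + b n * tri u v w m n + a n * tri u v w m n.+1)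
  - (u n * tri c b a m n.-1 + v n * tri c b a m n + w n * tri c b a m n.+1)
  = u n * tri u v w m n.-1 + v n * tri u v w m n + w n * tri u v w m n.+1
    + Delta * (m == n)%:R.
Proof.
case: rep => _ repX repZ _ [aN wN] _ _ mN nN.
rewrite -(tri_comp_coef repZ wN repX aN) // -(tri_comp_coef repX aN repZ wN) //.
rewrite -(tri_comp_coef repZ wN repZ wN) // -(orth mN nN) -/(coef _ _).
have relM : rho cZ *m rho cX - rho cX *m rho cZ = rho cZ *m rho cZ + Delta%:M.
  have := congr1 rho rel; rewrite rmorphB rmorphD rmorphXn !rmorphM /= linearZ /= rmorph1.
  by rewrite expr2 -scalemx1.
have := congr1 (fun M => coef m (M *m e n)) relM.
by rewrite mulmxBl mulmxDl mul_scalar_mx -scaleN1r !coefD !coefZ mulN1r.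
Qed.

(** This is the entry (n + 1, n); [relation_lower] and [relation_diag] use (n, n + 1) and (n, n). *)
Lemma relation_raise n : (n < N)%N ->
  b n * w n + a n * v n.+1 - (v n * a n + w n * b n.+1) = v n * w n + w n * v n.+1.
Proof.
move=> nN; have := relation_entry nN (ltnW nN); rewrite /tri.
have [c0 u0] := rep_bottom rep.
(* At n = 0 the index [n.-1] coincides with n; c_0 = u_0 = 0 removes the stray terms. *)
case: n {nN} => [|n]; rewrite /= ?c0 ?u0; decide_eqn => /= E;
  by apply: (@lincomb1 _ 1 _ _ _ _ E); ring.
Qed.

Lemma relation_lower n : (n < N)%N ->
  c n.+1 * v n + b n.+1 * u n.+1 - (u n.+1 * b n + v n.+1 * c n.+1)
  = u n.+1 * v n + v n.+1 * u n.+1.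
Proof.
move=> nN; have := relation_entry (ltnW nN) nN; rewrite /tri.
have [c0 u0] := rep_bottom rep.
case: n {nN} => [|n]; rewrite /= ?c0 ?u0; decide_eqn => /= E;
  by apply: (@lincomb1 _ 1 _ _ _ _ E); ring.
Qed.

Lemma relation_diag n : (n < N)%N ->
  c n * w n.-1 + a n * u n.+1 - (u n * a n.-1 + w n * c n.+1)
  = u n * w n.-1 + v n ^+ 2 + w n * u n.+1 + Delta.
Proof.
move=> nN; have := relation_entry (ltnW nN) (ltnW nN); rewrite /tri.
have [c0 u0] := rep_bottom rep.
case: n {nN} => [|n]; rewrite /= ?c0 ?u0; decide_eqn => /= E;
  by apply: (@lincomb1 _ 1 _ _ _ _ E); ring.
Qed.

Variables (phi0 delta0 v0 bt0 : C).
Hypothesis par : rep_parameters N c b a u v w phi0 delta0 v0 bt0.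

Lemma lowerE n : (n <= N)%N -> c n = (phi0 + n%:R) * u n.
Proof.
case: n => [|n] nN; first by have [-> ->] := rep_bottom rep; rewrite mulr0.
rewrite -(param_phi0 par) ?ltn0Sn // divfK //.
by case: (rep_lower_neq0 rep (n := n.+1)).
Qed.

Lemma upperE n : (n < N)%N -> a n = (delta0 - n%:R) * w n.
Proof. by move=> nN; rewrite -(param_delta0 par) // divfK //; case: (rep_upper_neq0 rep nN). Qed.

(** Division of the two off-diagonal entries by u_(n+1) and w_n gives [F1] and [F2]. Their sum
    eliminates b, and half their difference isolates b_(n+1) - b_n. *)
Lemma rep_v_rec n : (n < N)%N ->
  v n.+1 * (phi0 - delta0 + 2 * n%:R + 3) = v n * (phi0 - delta0 + 2 * n%:R - 1)
  /\ b n.+1 - b n = 2^-1 * (phi0 + delta0 + 1) * (v n.+1 - v n).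
Proof.
move=> nN; have := relation_raise nN; have := relation_lower nN.
rewrite (lowerE nN) (upperE nN) -natr1.
have [_ u1] := rep_lower_neq0 rep (n := n.+1) nN.
have [_ w0] := rep_upper_neq0 rep nN.
move=> E1 E2.
have F1 : (phi0 + n%:R + 1) * (v n - v n.+1) + b n.+1 - b n = v n + v n.+1.
  by apply: (mulfI u1); apply: (@lincomb1 _ 1 _ _ _ _ E1); ring.
have F2 : (delta0 - n%:R) * (v n.+1 - v n) + b n - b n.+1 = v n + v n.+1.
  by apply: (mulfI w0); apply: (@lincomb1 _ 1 _ _ _ _ E2); ring.
split; first by apply: (@lincomb2 _ (-1) (-1) _ _ _ _ _ _ F1 F2); ring.
have two : 2 != 0 :> C by rewrite pnatr_eq0.
by apply: (@lincomb2 _ (2^-1) (- 2^-1) _ _ _ _ _ _ F1 F2); field.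
Qed.

(** With c_n = (phi0 + n) u_n and a_n = (delta0 - n) w_n the diagonal entry involves only v_n and
    the products w_(n-1) u_n. *)
Lemma rep_wu_rec n : (n < N)%N ->
  (phi0 - delta0 + 2 * n%:R - 2) * (w n.-1 * u n)
  - (phi0 - delta0 + 2 * n%:R + 2) * (w n * u n.+1) = v n ^+ 2 + Delta.
Proof.
move=> nN; have := relation_diag nN.
rewrite (lowerE nN) (lowerE (ltnW nN)) (upperE nN) -(@natr1 _ n).
case: n nN => [|n] nN /=.
  by have [_ ->] := rep_bottom rep => E; apply: (@lincomb1 _ 1 _ _ _ _ E); ring.
rewrite (upperE (ltnW nN)) -(@natr1 _ n) => E; apply: (@lincomb1 _ 1 _ _ _ _ E); ring.
Qed.

Lemma rep_ac n : (n <= N)%N ->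
  a n.-1 * c n = (delta0 - n%:R + 1) * (phi0 + n%:R) * (w n.-1 * u n).
Proof.
case: n => [|n] nN; first by have [-> ->] := rep_bottom rep; rewrite !mulr0.
by rewrite (lowerE nN) /= (upperE nN) -(@natr1 _ n); ring.
Qed.

End Tridiagonal.

Ltac nonzero := repeat (apply/andP; split); assumption.

(** * Solution of the recurrences, with [U n] standing for w_(n-1) u_n *)

Section HahnCoefficients.
Variables (C : numClosedFieldType) (alpha beta : C) (N : nat) (v b U : nat -> C).
Hypothesis s2 : alpha + beta + 2 != 0.
Hypothesis v0 : v 0%N = - ((alpha + beta + 2 * N%:R + 2) / (2 * (alpha + beta + 2))).
Hypothesis b0 : b 0%N = (alpha + 1) * N%:R / (alpha + beta + 2).
Hypothesis U0 : U 0%N = 0.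
Hypothesis v_rec : forall n, (n < N)%N ->
  v n.+1 * (alpha + beta + 2 * n%:R + 4) = v n * (alpha + beta + 2 * n%:R).
Hypothesis b_rec : forall n, (n < N)%N ->
  b n.+1 - b n = 2^-1 * (beta - alpha) * (v n.+1 - v n).
Hypothesis U_rec : forall n, (n < N)%N ->
  (alpha + beta + 2 * n%:R - 1) * U n - (alpha + beta + 2 * n%:R + 3) * U n.+1
  = v n ^+ 2 - 4^-1.

Let two : 2 != 0 :> C. Proof. by rewrite pnatr_eq0. Qed.
Let four : 4 != 0 :> C. Proof. by rewrite pnatr_eq0. Qed.

(** [v_rec] times alpha + beta + 2 n + 2 says that the left side is independent of n. No division
    occurs, since the factors are not yet known to be non-zero. *)
Lemma v_closed n : (n <= N)%N ->
  v n * ((alpha + beta + 2 * n%:R) * (alpha + beta + 2 * n%:R + 2)) =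
  - ((alpha + beta) * (alpha + beta + 2 * N%:R + 2) / 2).
Proof.
elim: n => [|n IH] nN; first by rewrite v0; field; nonzero.
rewrite -(IH (ltnW nN)) -(@natr1 _ n).
by apply: (@lincomb1 _ (alpha + beta + 2 * n%:R + 2) _ _ _ _ (v_rec nN)); ring.
Qed.

(** If alpha + beta = -2 n, the left side of [v_closed] vanishes while the right side is 2 n (N + 1
    - n). *)
Lemma even_neq0 n : (0 < n <= N)%N -> alpha + beta + 2 * n%:R != 0.
Proof.
move=> /andP[n0 nN]; apply/eqP => E; have /eqP := v_closed nN.
have -> : alpha + beta = - (2 * n%:R) by apply: (@lincomb1 _ 1 _ _ _ _ E); ring.
have -> : - (2 * n%:R) + 2 * N%:R + 2 = 2 * (- n%:R + N.+1%:R) :> C by rewrite -natr1; ring.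
rewrite addNr mul0r mulr0 eq_sym oppr_eq0 !mulf_eq0 oppr_eq0 mulf_eq0 invr_eq0 (negPf two) /=.
rewrite pnatr_eq0 (negPf (natrB_neq0 _ _)) ?orbF; lia.
Qed.

Lemma evenS_neq0 n : (n < N)%N -> alpha + beta + 2 * n%:R + 2 != 0.
Proof. by move=> nN; have := @even_neq0 n.+1 nN; rewrite -(@natr1 _ n) mulrDr mulr1 addrA. Qed.

Lemma vE n : (0 < n < N)%N ->
  v n = - ((alpha + beta) * (alpha + beta + 2 * N%:R + 2)
          / (2 * ((alpha + beta + 2 * n%:R) * (alpha + beta + 2 * n%:R + 2)))).
Proof.
move=> /andP[n0 nN].
have e0 : alpha + beta + 2 * n%:R != 0 by rewrite even_neq0 // n0 ltnW.
have e1 : alpha + beta + 2 * n%:R + 2 != 0 by exact: evenS_neq0.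
apply: (mulIf (mulf_neq0 e0 e1)); rewrite v_closed ?(ltnW nN) //.
by field; nonzero.
Qed.

(* The denominators are cleared because 2 n + alpha + beta - 1 and
   2 n + alpha + beta + 1 are not yet known to be non-zero. *)
Lemma U_closed n : (0 < n <= N)%N ->
  (alpha + beta + 2 * n%:R - 1) * (alpha + beta + 2 * n%:R + 1)
    * (alpha + beta + 2 * n%:R) ^+ 2 * U n =
  n%:R * (alpha + beta + n%:R) * (n%:R - N%:R - 1) * (alpha + beta + n%:R + N%:R + 1).
Proof.
(* The induction starts at 1 because its step divides by (alpha + beta + 2 n)^2, and alpha + beta
   may vanish. *)
case: n => // n /=; elim: n => [|n IH] nN.
  have := U_rec nN; rewrite U0 v0 => E.
  apply: (@lincomb1 _ (- (alpha + beta + 1) * (alpha + beta + 2) ^+ 2) _ _ _ _ E).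
  by field; nonzero.
have E := U_rec nN; have := IH (ltnW nN).
rewrite (@vE n.+1) // in E.
have e0 := @even_neq0 n.+1 (ltnW nN).
have e1 : alpha + beta + 2 * n.+1%:R + 2 != 0 by exact: evenS_neq0.
move: e0 e1 E; rewrite -(@natr1 _ n.+1); set x := n.+1%:R => e0 e1 E F.
(* With s = alpha + beta, [U_rec] times s + 2 x + 1 telescopes in (s + 2 x - 1) (s + 2 x + 1) [U x];
   the squares adjust the cleared denominators. *)
apply: (@lincomb2 _ (- (alpha + beta + 2 * x + 1) * (alpha + beta + 2 * x + 2) ^+ 2)
   ((alpha + beta + 2 * x + 2) ^+ 2 / (alpha + beta + 2 * x) ^+ 2) _ _ _ _ _ _ E F).
clearbody x.
by field; nonzero.
Qed.

(** If alpha + beta = -2 n - 1, the left side of [U_closed] vanishes while the right side is n (n +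
    1) (N + 1 - n) (N - n). *)
Lemma odd_neq0 n : (0 < n < N)%N -> alpha + beta + 2 * n%:R + 1 != 0.
Proof.
move=> /andP[n0 nN]; apply/eqP => E; have := @U_closed n.
rewrite n0 ltnW // E mulr0 !mul0r => /(_ isT) /eqP; rewrite eq_sym.
have sE : alpha + beta = - (2 * n%:R) - 1 by apply: (@lincomb1 _ 1 _ _ _ _ E); ring.
have -> : alpha + beta + n%:R = - n.+1%:R by rewrite sE -natr1; ring.
have -> : - n.+1%:R + N%:R + 1 = - n%:R + N%:R :> C by rewrite -natr1; ring.
have -> : n%:R - N%:R - 1 = - (- n%:R + N.+1%:R) :> C by rewrite -natr1; ring.
rewrite !mulf_eq0 !oppr_eq0 !pnatr_eq0 !(negPf (natrB_neq0 _ _)) //; lia.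
Qed.

Lemma sum_neq0 m : (1 < m <= N.*2)%N -> alpha + beta + m%:R != 0.
Proof.
move=> mN; rewrite -[m]odd_double_half; case: (boolP (odd m)) => /= om.
  rewrite natrD addrCA addrC -mul2n natrM; apply: odd_neq0; lia.
rewrite add0n -mul2n natrM; apply: even_neq0; lia.
Qed.

Lemma bE n : (n < N)%N -> b n = hahnA alpha beta N n + hahnC alpha beta N n.
Proof.
move=> nN.
(* [b_rec] telescopes, which reduces b_n to the closed form of v_n. *)
have bv : b n - b 0%N = 2^-1 * (beta - alpha) * (v n - v 0%N).
  elim: n nN => [|n IH] nN; first by rewrite !subrr mulr0.
  by apply: (@lincomb2 _ 1 1 _ _ _ _ _ _ (IH (ltnW nN)) (b_rec (ltnW nN))); ring.
case: n nN bv => [|n] nN bv; first by rewrite /hahnA /hahnC !mul0r addr0.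
have e0 := @even_neq0 n.+1 (ltnW nN).
have o0 := @odd_neq0 n.+1 nN.
have e1 : alpha + beta + 2 * n.+1%:R + 2 != 0 by exact: evenS_neq0.
rewrite b0 v0 vE // in bv.
rewrite /hahnA /hahnC; move: e0 o0 e1 bv; set x := n.+1%:R => e0 o0 e1 bv.
apply: (@lincomb1 _ 1 _ _ _ _ bv); clearbody x.
have p1 : 2 * x + alpha + beta = alpha + beta + 2 * x by ring.
rewrite !p1; field; nonzero.
Qed.

(** The left side is a_(n-1) c_n as given by [rep_ac], at phi0 = beta and delta0 = - (alpha + 1). *)
Lemma UE n : (n < N)%N -> - ((alpha + n%:R) * (beta + n%:R) * U n) =
  hahnA alpha beta N n.-1 * hahnC alpha beta N n.
Proof.
case: n => [|[|n]] nN; first by rewrite U0 /hahnC !mul0r !mulr0 oppr0.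
  (* For n = 1 [U_closed] carries the factor alpha + beta + 1, which may vanish; [U 1] is read off
     from [U_rec] at 0 instead. *)
  have o0 := @odd_neq0 1%N nN.
  have := U_rec (ltnW nN); rewrite U0 v0 /hahnA /hahnC /= => E.
  apply: (@lincomb1 _ ((alpha + 1) * (beta + 1) / (alpha + beta + 2 * 1 + 1)) _ _ _ _ E).
  by rewrite mulr1 in o0 *; field; nonzero.
have := @U_closed n.+2 (ltnW nN).
have e0 := @even_neq0 n.+2 (ltnW nN).
have o0 := @odd_neq0 n.+2 nN.
have o1 := @odd_neq0 n.+1 (ltnW nN).
rewrite /hahnA /hahnC /=.
move: e0 o0 o1; rewrite -(@natr1 _ n.+1); set x := n.+1%:R => e0 o0 o1 E.
have o1' : alpha + beta + 2 * (x + 1) - 1 != 0.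
  by have -> : alpha + beta + 2 * (x + 1) - 1 = alpha + beta + 2 * x + 1 by ring.
have e2 := mulf_neq0 (mulf_neq0 o1' o0) (expf_neq0 2 e0).
rewrite (canRL (mulKf e2) E).
have p1 y : 2 * y + alpha + beta = alpha + beta + 2 * y by ring.
by clearbody x; rewrite !p1; field; nonzero.
Qed.

End HahnCoefficients.

(** * From the representation to the Hahn coefficients *)

(** The parameters give phi0 - delta0 = alpha + beta + 1 and phi0 + delta0 + 1 = beta - alpha.
    Regularity is derived from the existence of the representation. *)
Lemma rep_hahn (C : numClosedFieldType) (A : algType C) (cX cZ : A)
    (N : nat) (rho : {lrmorphism A -> 'M[C]_N.+1}) (e : nat -> 'cV[C]_N.+1)
    (c b a u v w : nat -> C) (phi0 delta0 v0 bt0 alpha beta : C) :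
  defining_relation (- 4^-1) cX cZ ->
  tridiagonal_rep cX cZ rho e c b a u v w ->
  rep_parameters N c b a u v w phi0 delta0 v0 bt0 ->
  alpha + beta + 2 != 0 -> phi0 = beta -> - delta0 = alpha + 1 ->
  v0 = - ((alpha + beta + 2 * N%:R + 2) / (2 * (alpha + beta + 2))) ->
  bt0 = 4^-1 * (2 * N%:R - alpha + beta) ->
  [/\ hahn_regular alpha beta N,
      forall n, (n < N)%N -> b n = hahnA alpha beta N n + hahnC alpha beta N n
    & forall n, (n < N)%N ->
        a n.-1 * c n = hahnA alpha beta N n.-1 * hahnC alpha beta N n].
Proof.
move=> rel rep par s2 phiE deltaN v0E btE.
have deltaE : delta0 = - (alpha + 1) by rewrite -deltaN opprK.
have orth := rep_basis rep.
have two : 2 != 0 :> C by rewrite pnatr_eq0.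
have four : 4 != 0 :> C by rewrite pnatr_eq0.
have v0' : v 0%N = - ((alpha + beta + 2 * N%:R + 2) / (2 * (alpha + beta + 2))).
  by rewrite -(param_v0 par).
have b0 : b 0%N = (alpha + 1) * N%:R / (alpha + beta + 2).
  have := param_bt0 par; rewrite btE v0E phiE deltaE => E.
  by apply: (@lincomb1 _ (-1) _ _ _ _ E); field; nonzero.
pose U n := w n.-1 * u n.
have U0 : U 0%N = 0 by rewrite /U (rep_bottom rep).2 mulr0.
have v_rec n : (n < N)%N ->
    v n.+1 * (alpha + beta + 2 * n%:R + 4) = v n * (alpha + beta + 2 * n%:R).
  move=> nN; have [E _] := rep_v_rec orth rel rep par nN.
  by apply: (@lincomb1 _ 1 _ _ _ _ E); rewrite phiE deltaE; ring.
have b_rec n : (n < N)%N -> b n.+1 - b n = 2^-1 * (beta - alpha) * (v n.+1 - v n).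
  move=> nN; have [_ ->] := rep_v_rec orth rel rep par nN.
  by rewrite phiE deltaE; congr (_ * _ * _); ring.
have U_rec n : (n < N)%N -> (alpha + beta + 2 * n%:R - 1) * U n
    - (alpha + beta + 2 * n%:R + 3) * U n.+1 = v n ^+ 2 - 4^-1.
  move=> nN; have E := rep_wu_rec orth rel rep par nN.
  by apply: (@lincomb1 _ 1 _ _ _ _ E); rewrite phiE deltaE /U /=; ring.
split=> [|n nN|n nN].
- split=> [k kN|m mN]; last exact: (sum_neq0 s2 v0' U0 v_rec U_rec).
  (* A zero of alpha + 1 + k is a zero of delta0 - k, hence of a_k. *)
  have [ak _] := rep_upper_neq0 rep kN.
  apply: contraNneq ak => E; rewrite (upperE rep par kN) deltaE.
  by rewrite -opprD E oppr0 mul0r.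
- exact: (bE s2 v0' b0 U0 v_rec b_rec U_rec).
rewrite (rep_ac rep par (ltnW nN)) -(UE s2 v0' U0 v_rec U_rec nN) phiE deltaE.
by rewrite -/(U n); ring.
Qed.

(** * Normalization of Delta and identification of the eigenfunctions *)

Theorem proposition3 (C : numClosedFieldType) :
  (forall (Delta : C) (A : algType C) (cX cZ : A),
     Delta < 0 -> presented_by Delta cX cZ ->
     exists2 lam : C, 0 < lam &
       presented_by (- 4^-1) (lam *: cX) (lam *: cZ))
  /\
  (forall (A : algType C) (cX cZ : A)
     (N : nat) (rho : {lrmorphism A -> 'M[C]_N.+1}) (e : nat -> 'cV[C]_N.+1)
     (c b a u v w : nat -> C) (phi0 delta0 v0 bt0 alpha beta : C),
     presented_by (- 4^-1) cX cZ ->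
     tridiagonal_rep cX cZ rho e c b a u v w ->
     rep_parameters N c b a u v w phi0 delta0 v0 bt0 ->
     alpha + beta + 2 != 0 ->
     phi0 = beta ->
     - delta0 = alpha + 1 ->
     v0 = - ((alpha + beta + 2 * N%:R + 2) / (2 * (alpha + beta + 2))) ->
     bt0 = 4^-1 * (2 * N%:R - alpha + beta) ->
     [/\ dimension_condition (- 4^-1) N phi0 delta0 v0,
         forall p : nat -> {poly C}, monic_recurrence N c b a p ->
           forall n, (n <= N)%N -> p n = monic_hahn alpha beta N n
       & forall (x : C) (bra : 'rV[C]_N.+1),
           bra *m rho cX = x *: bra ->
           forall n, (n <= N)%N ->
             (\prod_(i < n) a i) * (bra *m e n) 0 0 =
             (bra *m e 0%N) 0 0 * (monic_hahn alpha beta N n).[x]]).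
Proof.
split=> [Delta A cX cZ D0 pres|].
  have d0 : 0 < - Delta by rewrite oppr_gt0.
  (* This factor is the positive solution of lam^2 Delta = -1/4. *)
  have l0 : 0 < (2 * sqrtC (- Delta))^-1 by rewrite invr_gt0 mulr_gt0 // sqrtC_gt0.
  exists (2 * sqrtC (- Delta))^-1 => //.
  suff <- : (2 * sqrtC (- Delta))^-1 ^+ 2 * Delta = - 4^-1.
    exact: presented_by_scale (lt0r_neq0 l0) pres.
  rewrite exprVn exprMn sqrtCK; field.
  by rewrite (ltr0_neq0 D0).
move=> A cX cZ N rho e c b a u v w phi0 delta0 v0 bt0 alpha beta pres rep par.
move=> s2 phiE deltaN v0E btE.
have [reg bH gH] :=
  rep_hahn (presented_relation pres) rep par s2 phiE deltaN v0E btE.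
have M0 : monic_hahn alpha beta N 0 = 1.
  rewrite /monic_hahn /hahn_3F2 big_ord_recl big_ord0 -/(hahn_coef _ _ _ _ _).
  by rewrite hahn_coef0 poch0 addr0 scale1r lead_coef1 invr1 scale1r.
have MS n : (n < N)%N -> monic_hahn alpha beta N n.+1 =
    'X * monic_hahn alpha beta N n - b n *: monic_hahn alpha beta N n
    - (a n.-1 * c n) *: monic_hahn alpha beta N n.-1.
  by move=> nN; rewrite (monic_hahn_rec reg nN) bH // gH //; ring.
split.
(* The plus sign is the right one: the root is 2, and the bracket becomes alpha + beta - (alpha +
   beta + 2 N + 2). *)
- exists false; rewrite expr0 mul1r invrN invrK opprK.
  have -> : sqrtC 4 = 2 :> C.
    have -> : 4 = 2 ^+ 2 :> C by rewrite -natrX.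
    by rewrite sqrCK // ler0n.
  have -> : delta0 = - (alpha + 1) by rewrite -deltaN opprK.
  rewrite phiE v0E -natr1; field.
  by rewrite s2.
- move=> p [p0 pS].
  apply: (three_term_unique (G := fun n f f' => 'X * f - b n *: f - (a n.-1 * c n) *: f')).
  + by rewrite p0 M0.
  + by move=> n nN; rewrite pS ?(ltnW nN) //; ring.
  exact: MS.
move=> x bra braX.
(* The values q_n = <x|n> obey the recurrence of X; multiplied by a_0 ... a_(n-1) they obey the
   monic one. *)
apply: (three_term_unique (G := fun n f f' => x * f - b n * f - a n.-1 * c n * f')).
- by rewrite big_ord0 mul1r M0 hornerE mulr1.
- move=> n nN.
  have := congr1 (fun M : 'M_1 => M 0 0) (congr1 (mulmx bra) (rep_X rep (ltnW nN))).
  rewrite mulmxA braX !mulmxDr -!scalemxAr -scalemxAl.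
  move: (bra *m e n) (bra *m e n.+1) (bra *m e n.-1) => y y1 y0.
  rewrite !mxE => E.
  rewrite big_ord_recr /=.
  set p := \prod_(i < n) a i.
  (* The factor a_(n-1) is split off the product to pair with c_n; at n = 0 both sides vanish with
     c_0. *)
  have pE : p * c n = (\prod_(i < n.-1) a i) * (a n.-1 * c n).
    rewrite /p; case: n {nN E p} => [|n].
      by rewrite (rep_bottom rep).1 !mulr0.
    by rewrite big_ord_recr /= mulrA.
  by apply: (@lincomb2 _ (- p) (- y0 0 0) _ _ _ _ _ _ E pE); ring.
move=> n nN; rewrite MS //; move: (monic_hahn _ _ N n) (monic_hahn _ _ N n.-1) => P Q.
by rewrite !(hornerD, hornerN, hornerZ, hornerM, hornerX); ring.
Qed.
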